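(* Let $a>b$ be positive integers and write $d=a-b$. There is a partition $\lambda$ which is both $(a,b)$-birectangular and $(b,a)$-birectangular if and only if $d\mid a$. Moreover, in such a case there is a unique such $\lambda$, given by $((2b)^{2d},(2b-2d)^{2d},\dots,(2d)^{2d})$.
   Context: A partition is a non-increasing sequence of positive integers, extended by zeros where necessary ($\lambda_i=0$ for $i$ larger than the number of parts); $c^e$ denotes $e$ parts equal to $c$. For positive integers $a,b$, a partition $\lambda$ of $2ab$ is $(a,b)$-birectangular if $\lambda_i+\lambda_{2b+1-i}=2a$ for all $1\leq i\leq 2b$. (Equivalently, the irreducible character $\chi^\lambda$ of $S_{2ab}$ is a constituent of $(\chi^{(a^b)}\boxtimes\chi^{(a^b)})\uparrow_{S_{ab}\times S_{ab}}^{S_{2ab}}$.) *)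

(* Defs.v *)
From mathcomp Require Import all_boot.

Set Implicit Arguments.
Unset Strict Implicit.
Unset Printing Implicit Defensive.

Definition is_partition (lam : seq nat) : bool :=
  sorted geq lam && (0 \notin lam).

Definition partition_of (n : nat) (lam : seq nat) : bool :=
  is_partition lam && (sumn lam == n).

(* Parts are numbered from 1; lam_i = 0 past the number of parts. The value at
   i = 0 is junk (it is the first part) and is never used below. *)
Definition part (lam : seq nat) (i : nat) : nat := nth 0 lam i.-1.

Definition birectangular (a b : nat) (lam : seq nat) : Prop :=
  partition_of (2 * a * b) lam /\
  forall i, 1 <= i <= 2 * b -> part lam i + part lam (2 * b + 1 - i) = 2 * a.

(* ((2b)^{2d}, (2b-2d)^{2d}, ..., (2d)^{2d}): block k has parts 2b - 2dk for
   0 <= k < b/d. Meaningful when 0 < d and d divides b. *)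
Definition staircase (b d : nat) : seq nat :=
  flatten [seq nseq (2 * d) (2 * b - 2 * d * k) | k <- iota 0 (b %/ d)].

(* Main.v *)
Require Import Defs.
From mathcomp Require Import all_boot zify.

(** Number the parts from 0. The two symmetries have different centres, so
    composing them gives [lam_(j + 2d) = lam_j - 2d] for [j < 2b]. The symmetry
    of length [2b] already accounts for the whole size [2ab], so there are at
    most [2b] parts; the symmetry of length [2a] then makes the first [2d] parts
    equal to [2b]. Hence [lam_j = 2b - 2d * floor (j / 2d)] for [j < 2a], and
    [lam_(2b) = 0] forces [d] to divide [b], i.e. [a]. *)

(** If one list were longer, its entry just past the end of the other would equal the default 0,
    which is not among its entries. *)
Lemma eq_from_nth0 (s t : seq nat) : 0 \notin s -> 0 \notin t ->
  nth 0 s =1 nth 0 t -> s = t.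
Proof.
have le_size (u v : seq nat) : 0 \notin v -> nth 0 u =1 nth 0 v ->
    size v <= size u.
  move=> v0 uv; rewrite leqNgt; apply: contra v0 => lt_uv.
  by rewrite -(nth_default 0 (leqnn (size u))) uv mem_nth.
move=> s0 t0 st; apply: (@eq_from_nth _ 0) => [|i _]; last exact: st.
by apply/eqP; rewrite eqn_leq !le_size // => i; rewrite st.
Qed.

Lemma sumn_nth (s : seq nat) : \sum_(i < size s) nth 0 s i = sumn s.
Proof. by rewrite sumnE (big_nth 0) big_mkord. Qed.

Lemma sum_symmetric (n c : nat) (f : nat -> nat) :
  (forall i, i < n -> f i + f (n - 1 - i) = c) ->
  2 * \sum_(i < n) f i = n * c.
Proof.
move=> fc; rewrite mul2n -addnn {2}(reindex_inj rev_ord_inj) -big_split /=.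
rewrite (eq_bigr (fun=> c)) ?sum_nat_const ?card_ord // => i _.
by rewrite -[RHS](fc i (ltn_ord i)) -subnDA add1n.
Qed.

(** Reversing [q] blocks of length [m] sends block [k] to block [q - 1 - k]. *)
Lemma divn_complement (m q j : nat) : j < q * m ->
  (q * m - 1 - j) %/ m + j %/ m + 1 = q.
Proof.
case: m => [|m] lt_j; first by rewrite muln0 in lt_j.
have lt_u : j %/ m.+1 < q by rewrite ltn_divLR.
have lt_r : j %% m.+1 < m.+1 by rewrite ltn_mod.
(* After the case split the block length is [m.+1], so the reversed remainder is [m - j %% m.+1]. *)
have -> : q * m.+1 - 1 - j = (q - 1 - j %/ m.+1) * m.+1 + (m - j %% m.+1).
  by rewrite {1}(divn_eq j m.+1); nia.
rewrite divnMDl // [(m - _) %/ _]divn_small ?ltnS ?leq_subr // addn0.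
by move: (j %/ m.+1) lt_u => u; lia.
Qed.

Lemma nth_flatten_nseq (m n k j : nat) (f : nat -> nat) : 0 < m ->
  nth 0 (flatten [seq nseq m (f i) | i <- iota k n]) j =
  if j < n * m then f (k + j %/ m) else 0.
Proof.
move=> m0; elim: n k j => [|n IHn] k j /=; first by rewrite nth_nil.
rewrite nth_cat size_nseq nth_nseq; case: ltnP => [lt_jm|le_mj].
  by rewrite mulSn ltn_addr // divn_small // addn0.
rewrite IHn mulSn -{3 4}(subnKC le_mj) ltn_add2l.
by rewrite divnDl ?dvdnn // divnn m0 addnA addn1.
Qed.

Lemma size_flatten_nseq (m n k : nat) (f : nat -> nat) :
  size (flatten [seq nseq m (f i) | i <- iota k n]) = n * m.
Proof. by elim: n k => //= n IHn k; rewrite size_cat size_nseq IHn mulSn. Qed.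

(** Past the last block, truncated subtraction gives the default 0, so one formula serves every
    [j]. *)
Lemma nth_staircase (q d j : nat) : 0 < d ->
  nth 0 (staircase (q * d) d) j = 2 * d * (q - j %/ (2 * d)).
Proof.
move=> d0; rewrite /staircase nth_flatten_nseq ?muln_gt0 // mulnK // add0n.
case: ltnP => [_|le_qj]; first by rewrite mulnBr (mulnC q) mulnA.
by rewrite (eqP (_ : q - _ == 0)) ?muln0 // subn_eq0 leq_divRL ?muln_gt0.
Qed.

Lemma size_staircase (q d : nat) : 0 < d ->
  size (staircase (q * d) d) = q * (2 * d).
Proof. by move=> d0; rewrite /staircase size_flatten_nseq mulnK. Qed.

Lemma staircase_is_partition (q d : nat) : 0 < d ->
  is_partition (staircase (q * d) d).
Proof.
move=> d0; apply/andP; split.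
  apply/(sortedP 0) => i _; rewrite !nth_staircase //=.
  by rewrite leq_mul2l leq_sub2l ?orbT // leq_div2r.
apply/(nthP 0) => -[j]; rewrite size_staircase // nth_staircase // => lt_j.
by have : j %/ (2 * d) < q by [rewrite ltn_divLR ?muln_gt0]; nia.
Qed.

(** With b = qd and a = (q+1)d, the cases [p = q] and [p = q.+1] are the symmetries of length 2b and
    2a. Mirrored block numbers add up to [p - 1], and neither exceeds [q], so no subtraction
    truncates. *)
Lemma staircase_symmetric (q p d j : nat) : 0 < d -> p <= q.+1 ->
  q <= p -> j < p * (2 * d) ->
  nth 0 (staircase (q * d) d) j +
    nth 0 (staircase (q * d) d) (p * (2 * d) - 1 - j) =
  2 * ((2 * q + 1 - p) * d).
Proof.
move=> d0 le_pq le_qp lt_j; rewrite !nth_staircase // -mulnDr.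
rewrite [in RHS](mulnC _ d) [RHS]mulnA; congr (_ * _).
have := divn_complement _ _ _ lt_j.
by move: (_ %/ _) (_ %/ _) => u v; lia.
Qed.

Lemma sumn_staircase (q d : nat) : 0 < d ->
  sumn (staircase (q * d) d) = 2 * (q.+1 * d) * (q * d).
Proof.
move=> d0; rewrite -sumn_nth size_staircase //.
have := @sum_symmetric (q * (2 * d)) _ (nth 0 (staircase (q * d) d))
  (fun i lt_i => staircase_symmetric q q d i d0 (leqnSn q) (leqnn q) lt_i).
by have -> : 2 * q + 1 - q = q.+1 by [lia]; nia.
Qed.

Lemma part_symmetricP (a b : nat) (lam : seq nat) :
  (forall i, 1 <= i <= 2 * b -> part lam i + part lam (2 * b + 1 - i) = 2 * a)
  <-> (forall j, j < 2 * b -> nth 0 lam j + nth 0 lam (2 * b - 1 - j) = 2 * a).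
Proof.
rewrite /part; split=> sym.
  move=> j lt_j; rewrite -(sym j.+1) //=.
  by congr (_ + nth _ _ _); lia.
move=> [|i] //= lt_i; rewrite -(sym i) //.
by congr (_ + nth _ _ _); lia.
Qed.

Lemma staircase_birectangular (q d : nat) : 0 < d ->
  birectangular (q.+1 * d) (q * d) (staircase (q * d) d) /\
  birectangular (q * d) (q.+1 * d) (staircase (q * d) d).
Proof.
move=> d0; split; split; rewrite /partition_of ?staircase_is_partition //=.
- by rewrite sumn_staircase.
- apply/part_symmetricP => j; rewrite (mulnCA 2) => lt_j.
  by rewrite staircase_symmetric //; congr (2 * (_ * d)); lia.
- by rewrite sumn_staircase // mulnAC.
- apply/part_symmetricP => j; rewrite (mulnCA 2) => lt_j.
  by rewrite staircase_symmetric //; congr (2 * (_ * d)); lia.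
Qed.

Lemma birectangular_size (a b : nat) (lam : seq nat) :
  birectangular a b lam -> size lam <= 2 * b.
Proof.
case=> /andP[/andP[_ lam0] /eqP sum_lam] /part_symmetricP sym.
rewrite leqNgt; apply: contra lam0 => lt_b.
have := sum_symmetric _ _ _ sym.
have <- : sumn (take (2 * b) lam) = \sum_(i < 2 * b) nth 0 lam i.
  rewrite -sumn_nth size_takel ?(ltnW lt_b) //.
  by apply: eq_bigr => i _; rewrite nth_take.
move=> sum_take.
move: sum_lam; rewrite -{1}(cat_take_drop (2 * b) lam) sumn_cat.
rewrite (drop_nth 0) //= => sum_lam.
(* Pairing gives the first [2 * b] entries the full sum [2 * a * b], so the next entry would be a
   forbidden 0. *)
have <- : nth 0 lam (2 * b) = 0 by nia.
exact: mem_nth.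
Qed.

Lemma birectangular_both_nth (b d : nat) (lam : seq nat) : 0 < d ->
  birectangular (b + d) b lam -> birectangular b (b + d) lam ->
  forall j, j < 2 * (b + d) -> nth 0 lam j + 2 * d * (j %/ (2 * d)) = 2 * b.
Proof.
move=> d0 bi_ab [_ /part_symmetricP symB].
have tail0 j : 2 * b <= j -> nth 0 lam j = 0.
  by move=> le_bj; rewrite nth_default // (leq_trans (birectangular_size _ _ _ bi_ab)).
case: bi_ab => _ /part_symmetricP symA.
elim/ltn_ind => j IHj lt_j; have [lt_jd|le_dj] := ltnP j (2 * d).
  (* In the first block, the mirror index [2 * (b + d) - 1 - j] is at least [2 * b], where [lam]
     vanishes. *)
  by rewrite divn_small // -(symB j) // (tail0 (_ - j)); lia.
have := IHj (j - 2 * d); have := symA (j - 2 * d); have := symB j lt_j.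
(* The short symmetry at [j - 2 * d] and the long one at [j] share their mirror index; subtracting
   them shows a drop of [2 * d]. *)
have -> : 2 * b - 1 - (j - 2 * d) = 2 * (b + d) - 1 - j by lia.
have -> : j %/ (2 * d) = (j - 2 * d) %/ (2 * d) + 1.
  by rewrite -{1}(subnK le_dj) divnDr // divnn muln_gt0 d0.
by rewrite mulnDr; move: ((j - 2 * d) %/ (2 * d)) => u; lia.
Qed.

Lemma birectangular_both_dvdn (b d : nat) (lam : seq nat) : 0 < d ->
  birectangular (b + d) b lam -> birectangular b (b + d) lam -> d %| b.
Proof.
move=> d0 bi_ab bi_ba.
(* The index [2 * b] is past the end of [lam] but still below [2 * (b + d)], so the formula holds
   there with value 0. *)
have := birectangular_both_nth _ _ _ d0 bi_ab bi_ba (2 * b).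
rewrite nth_default ?(birectangular_size _ _ _ bi_ab) // add0n => eq_b.
have {}eq_b : 2 * d * (2 * b %/ (2 * d)) = 2 * b by apply: eq_b; lia.
by rewrite -(@dvdn_pmul2l 2) // -eq_b dvdn_mulr.
Qed.

Lemma birectangular_both_unique (b d : nat) (lam : seq nat) : 0 < d ->
  birectangular (b + d) b lam -> birectangular b (b + d) lam ->
  lam = staircase b d.
Proof.
move=> d0 bi_ab bi_ba; have size_lam := birectangular_size _ _ _ bi_ab.
have lam_nth := birectangular_both_nth _ _ _ d0 bi_ab bi_ba.
have /dvdnP[q def_b] := birectangular_both_dvdn _ _ _ d0 bi_ab bi_ba.
case: bi_ab => /andP[/andP[_ lam0] _] _.
apply: eq_from_nth0 => // [|j]; rewrite def_b.
  by case/andP: (staircase_is_partition q _ d0).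
rewrite nth_staircase // mulnBr -mulnA (mulnC d) -def_b; have [lt_j|le_j] := ltnP j (2 * (b + d)).
  by rewrite -(lam_nth _ lt_j) addnK.
(* Beyond the range of the formula both sides are 0, the right one by truncation. *)
rewrite nth_default; last by lia.
have : q <= j %/ (2 * d) by rewrite leq_divRL ?muln_gt0 //; nia.
by nia.
Qed.

Theorem proposition1p3 (a b d : nat) (b_gt0 : 0 < b) (b_lt_a : b < a)
    (def_d : d = a - b) :
  ((exists lam : seq nat, birectangular a b lam /\ birectangular b a lam)
     <-> d %| a) /\
  (d %| a -> forall lam : seq nat,
     (birectangular a b lam /\ birectangular b a lam) <->
     lam = staircase b d).
Proof.
have d0 : 0 < d by rewrite def_d subn_gt0.
have -> : a = b + d by rewrite def_d subnKC // ltnW.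
rewrite dvdn_addl //.
have staircaseP : d %| b -> birectangular (b + d) b (staircase b d) /\
    birectangular b (b + d) (staircase b d).
  by case/dvdnP=> q ->; rewrite addnC -mulSn; apply: staircase_birectangular.
split; last first.
  move=> dv lam; split=> [[]|->]; last exact: staircaseP.
  exact: birectangular_both_unique.
split=> [[lam []]|dv]; first exact: birectangular_both_dvdn.
by exists (staircase b d); apply: staircaseP.
Qed.
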